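(* Let $(\xi_n)_{n\ge 1}$ be a sequence of independent identically distributed random variables taking the values $0,1,2,3,4,5$ with probabilities $p_0,p_1,p_2,p_3,p_4,p_5$ respectively, where $p_i\ge 0$, $p_i<1$, $\sum_{i=0}^{5}p_i=1$, and let $\xi=\sum_{n=1}^{\infty}4^{-n}\xi_n$. If $$p_2=p_3=p_0+p_4=p_1+p_5=\tfrac14$$ and $p_1\ge p_0$, then $\xi$ has an absolutely continuous distribution.
   Context: A random variable has an absolutely continuous distribution if it takes values in any given Borel set of Lebesgue measure zero with probability $0$. *)

(* Defs.v *)
From HB Require Import structures.
From mathcomp Require Export all_boot all_order all_algebra.
From mathcomp Require Export all_classical all_reals all_analysis.
Export Order.TTheory GRing.Theory Num.Theory.
Export numFieldNormedType.Exports.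

Set Implicit Arguments.
Unset Strict Implicit.
Unset Printing Implicit Defensive.

Local Open Scope classical_set_scope.
Local Open Scope ring_scope.

Section random_variables.
Context {d : measure_display} {T : measurableType d} {R : realType}.
Context {P : probability T R}.

(* Mutual independence: the product rule holds for every finite subfamily,
   a finite set of indices being given by a duplicate-free list. *)
Definition mutually_independent (X : nat -> {RV P >-> R}) : Prop :=
  forall (J : seq nat) (A : nat -> set R), uniq J ->
    (forall n, measurable (A n)) ->
    P (\bigcap_(n in [set` J]) (X n @^-1` A n)) =
    (\prod_(n <- J) P (X n @^-1` A n))%E.

Definition identically_distributed (X : nat -> {RV P >-> R}) : Prop :=
  forall (m n : nat) (A : set R), measurable A ->
    distribution P (X m) A = distribution P (X n) A.

(* measurable : set R denotes the Borel sets of R. *)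
Definition absolutely_continuous_distribution (X : {RV P >-> R}) : Prop :=
  forall A : set R, measurable A -> lebesgue_measure A = 0%E ->
    distribution P X A = 0%E.

(* Y is almost surely the sum of the series of b^-n X_n over n >= 1, including
   its convergence; the sequence is stored from index 0, so that X n stands for
   the (n+1)-st variable and carries the weight b^-(n+1). *)
Definition as_digit_sum (b : R) (X : nat -> {RV P >-> R})
    (Y : {RV P >-> R}) : Prop :=
  {ae P, forall w,
    series (fun n => b ^- n.+1 * X n w) @ \oo --> (Y w : R)}.

End random_variables.

(* Main.v *)
(** If every residue class modulo [b] contains total digit mass at most [1 / b],
    then the integer [S_n = \sum_(k <= n) b ^ (n - k) xi_k] takes each single
    value with probability at most [b ^- n]: the residue of [j] constrains the
    last digit, and each admissible last digit determines [S_(n-1)].  Since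
    [b ^ n xi - S_n] lies in a bounded interval, [xi] falls in an interval of
    length [l] with probability at most [l + O(b ^- n)], hence at most [l], and
    the law of [xi] is dominated by the Lebesgue measure. *)
Require Import Defs.
From mathcomp Require Import zify ring lra.

Set Implicit Arguments.
Unset Strict Implicit.
Unset Printing Implicit Defensive.

Local Open Scope classical_set_scope.
Local Open Scope ring_scope.

(** * Comparison of a measure with the Lebesgue measure *)

Section domination.
Context {R : realType}.
Local Open Scope ereal_scope.

(** The Lebesgue measure is an infimum of total lengths over countable covers by half-open
    intervals; sigma-subadditivity of [mu] bounds [mu A] by the total length of each such cover. *)
Lemma le_lebesgue_measure (mu : {measure set R -> \bar R}) :
  (forall a b : R, (a <= b)%R -> mu `]a, b]%classic <= (b - a)%:E) ->
  forall A, measurable A -> mu A <= lebesgue_measure A.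
Proof.
move=> muI A mA; apply: le_ereal_inf_tmp => _ /= [F [mF AF] <-].
have mF' k : measurable (F k : set R).
  by apply: sub_sigma_algebra; exact: mF.
apply: (@le_trans _ _ (\sum_(k <oo) mu (F k))).
  exact: (measure_sigma_subadditive mu mF' mA AF).
apply: lee_nneseries => // k _.
have /ocitvP[->|[[a b] /= ab ->]] := mF k; first by rewrite measure0.
by rewrite wlength_itv_bnd ?(ltW ab)// EFinB; apply/muI/ltW.
Qed.

End domination.

Lemma measure_bigsetU_le d (T : ringOfSetsType d) (R : realFieldType)
    (mu : {content set T -> \bar R}) (I : Type) (s : seq I) (Q : pred I)
    (F : I -> set T) :
  (forall i, measurable (F i)) ->
  (mu (\big[setU/set0]_(i <- s | Q i) F i) <= \sum_(i <- s | Q i) mu (F i))%E.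
Proof.
move=> mF; elim: s => [|i s IH]; first by rewrite !big_nil measure0.
rewrite !big_cons; case: ifP => // _; apply: le_trans (measureU2 _ _ _) _ => //.
  exact: bigsetU_measurable.
exact: leeD2l.
Qed.

(** * Mass of the digit words with a given value *)

Section words.
Context {R : realFieldType} (b m : nat) (q : nat -> R).

(* The most significant digit comes first. *)
Fixpoint words n : seq (seq nat) :=
  if n is n'.+1 then [seq rcons w k | w <- words n', k <- iota 0 m]
  else [:: [::]].

(** Horner evaluation in base [b]. Digits range below [m], which may exceed [b], so distinct words
    can share a value. *)
Definition wval (w : seq nat) := foldl (fun v k => b * v + k)%N 0%N w.

Definition weight (w : seq nat) : R := \prod_(k <- w) q k.

Lemma wval_rcons w k : wval (rcons w k) = (b * wval w + k)%N.
Proof. by rewrite /wval -cats1 foldl_cat. Qed.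

Lemma mkseq_words (x : nat -> nat) n :
  (forall i, (x i < m)%N) -> mkseq x n \in words n.
Proof.
move=> xm; elim: n => [|n IH] //=; rewrite mkseqS.
by apply/allpairsP; exists (mkseq x n, x n); rewrite mem_iota xm.
Qed.

Lemma size_words n w : w \in words n -> size w = n.
Proof.
elim: n w => [|n IH] w /=; first by rewrite inE => /eqP ->.
by move=> /allpairsP[[v k] /= [/IH <- _ ->]]; rewrite size_rcons.
Qed.

Lemma words_lt n w : w \in words n -> all (fun k => k < m)%N w.
Proof.
elim: n w => [|n IH] w /=; first by rewrite inE => /eqP ->.
move=> /allpairsP[[v k] /= [/IH vm]]; rewrite mem_iota => /= km ->.
by rewrite all_rcons vm km.
Qed.

Hypothesis b_gt0 : (0 < b)%N.
Hypothesis q_ge0 : forall k, (k < m)%N -> 0 <= q k.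
Hypothesis q_mod :
  forall r, \sum_(k <- iota 0 m | k == r %[mod b]) q k <= b%:R^-1.

Lemma mass_le n j :
  \sum_(w <- words n | wval w == j) weight w <= (b%:R ^+ n)^-1.
Proof.
elim: n j => [|n IH] j.
  by rewrite /= big_mkcond big_seq1 invr1 /weight big_nil; case: ifP.
rewrite /= big_mkcond big_allpairs_dep exchange_big /=.
pose c := (b%:R ^+ n)^-1 : R.
(* With the last digit [k] outermost, [c] bounds the mass of the admissible prefixes and [q_mod]
   supplies the additional factor [1 / b]. *)
apply: (@le_trans _ _ (\sum_(k <- iota 0 m | k == j %[mod b]) q k * c));
  last first.
  by rewrite -mulr_suml exprS invfM ler_wpM2r ?invr_ge0 ?exprn_ge0.
rewrite big_seq [leRHS]big_seq_cond [leRHS]big_mkcondr; apply: ler_sum => k.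
rewrite mem_iota /= add0n => km; rewrite -big_mkcond /=.
under eq_bigl do rewrite wval_rcons.
case: ifPn => [/eqP kj|kj]; last first.
  by rewrite big1// => w /eqP wj; rewrite -wj mulnC modnMDl eqxx in kj.
under eq_bigr do rewrite /weight big_rcons /= mulrC.
rewrite -mulr_sumr ler_wpM2l ?q_ge0//.
(* The prefix must have value [(j - k) / b]. If [j < k] the truncated difference is 0, which is
   harmless: no word then satisfies the condition on the left, and weights are nonnegative. *)
apply: le_trans (IH ((j - k) %/ b)%N); rewrite big_mkcond [leRHS]big_mkcond.
rewrite big_seq [leRHS]big_seq; apply: ler_sum => w ww.
have [<-|_] := eqVneq; first by rewrite addnK mulKn// eqxx.
case: ifP => // _; rewrite /weight big_seq prodr_ge0// => i iw.
exact: q_ge0 (allP (words_lt ww) i iw).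
Qed.

End words.

(** * From independent digits to the law of their sum *)

Section digit_sums.
Context {d : measure_display} {T : measurableType d} {R : realType}.
Context {P : probability T R} (X : nat -> {RV P >-> R}).
Context (b m : nat) (q : nat -> R).
Hypothesis X_indep : mutually_independent X.
Hypothesis X_law :
  forall n k, (k < m)%N -> P (X n @^-1` [set k%:R]) = (q k)%:E.

Definition cylinder (w : seq nat) : set T :=
  \bigcap_(i in [set` iota 0 (size w)]) (X i @^-1` [set (nth 0%N w i)%:R]).

Lemma measurable_cylinder w : measurable (cylinder w).
Proof. exact: bigcap_measurableType. Qed.

Lemma probability_cylinder w :
  all (fun k => k < m)%N w -> P (cylinder w) = (weight q w)%:E.
Proof.
move=> /all_nthP wm.
rewrite /cylinder (X_indep (A := fun i => [set (nth 0%N w i)%:R])) ?iota_uniq//.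
rewrite /weight (big_nth 0%N) /index_iota subn0 -prodEFin.
rewrite big_seq [RHS]big_seq; apply: eq_bigr => i.
by rewrite mem_iota add0n => /= iw; rewrite X_law// wm.
Qed.

(** For fixed [n] the events [X n = k] with [k < m] are disjoint of total mass 1, so their union has
    a null complement; countably many null sets are discarded. *)
Lemma as_digits : \sum_(k < m) q k = 1 ->
  {ae P, forall t n, exists2 k, (k < m)%N & X n t = k%:R}.
Proof.
move=> q1; apply: ae_foralln => n.
pose U : set T := \big[setU/set0]_(k < m) (X n @^-1` [set k%:R]).
have mX k : measurable (X n @^-1` [set k%:R] : set T).
  exact: measurable_funPTI.
have mU : measurable U by apply: bigsetU_measurable.
exists (~` U); split; first exact: measurableC.
  rewrite [LHS]probability_setC// /U measure_bigsetU_ord//.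
    rewrite (eq_bigr (fun k : 'I_m => (q k)%:E)) => [|k _]; last exact: X_law.
    by rewrite sumEFin q1 subee.
  move=> i j _ _ [t [/= -> /eqP]]; rewrite eqr_nat => /eqP ij.
  exact: val_inj.
move=> t /=; apply: contra_not.
rewrite /U -(bigcup_mkord m (fun k => X n @^-1` [set k%:R])) => -[k /= km Xk].
by exists k.
Qed.

Hypothesis b_gt1 : (1 < b)%N.
Let b_gt0 : (0 < b)%N := ltnW b_gt1.
Let B : R := b%:R.
Let B_gt0 : 0 < B. Proof. by rewrite ltr0n. Qed.

Let B_expV_cvg0 : (fun n => B^-1 ^+ n) @ \oo --> 0.
Proof.
apply: cvg_expr.
by rewrite ger0_norm ?invr_ge0 ?(ltW B_gt0)// invf_lt1// ltr1n.
Qed.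

(** Scaled by [B ^+ n], the partial sum of the first [n] terms is the integer [wval], and the tail
    lies between 0 and [m], since digits lie in [[0, m)] and [B >= 2]. *)
Lemma digit_series_approx (x : nat -> R) (k : nat -> nat) (y : R) n :
  (forall i, (k i < m)%N) -> (forall i, x i = (k i)%:R) ->
  series (fun i => B ^- i.+1 * x i) @ \oo --> y ->
  B ^+ n * y - m%:R <= (wval b (mkseq k n))%:R <= B ^+ n * y.
Proof.
move=> km xk sy; set s := series _ in sy.
have Bn_gt0 i : 0 < B ^+ i by rewrite exprn_gt0.
have sS i : s i.+1 = s i + B ^- i.+1 * x i by rewrite /s /series /= big_nat_recr.
have -> : (wval b (mkseq k n))%:R = B ^+ n * s n.
  elim: n => [|n IH]; first by rewrite /s /series /= big_geq ?mulr0.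
  rewrite mkseqS wval_rcons natrD natrM IH sS mulrDr mulrA -exprS xk mulrA.
  by rewrite divff ?mul1r// gt_eqF.
apply/andP; split; last first.
  rewrite ler_wpM2l ?(ltW (Bn_gt0 _))// -(cvg_lim _ sy)//.
  apply: nondecreasing_cvgn_le; last by apply/cvg_ex; exists y.
  apply/nondecreasing_seqP => i.
  by rewrite sS lerDl xk mulr_ge0// invr_ge0 ltW.
(* Digits are less than m <= m (b - 1), so [s n + m B ^- n] decreases to [y]. *)
pose u := s + (fun i => m%:R * B^-1 ^+ i).
have uy : u @ \oo --> y.
  rewrite -[y]addr0; apply: cvgD => //; rewrite -[X in _ --> X](mulr0 m%:R).
  by apply: cvgMr; exact: B_expV_cvg0.
suff : y <= u n.
  rewrite lerBlDr => /(ler_wpM2l (ltW (Bn_gt0 n)))/le_trans; apply.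
  rewrite /u fctE mulrDr exprVn mulrCA divff ?mulr1//.
  by rewrite gt_eqF.
rewrite -(cvg_lim _ uy)//.
apply: nonincreasing_cvgn_ge; last by apply/cvg_ex; exists y.
apply/nonincreasing_seqP => i.
rewrite /u !fctE sS -addrA lerD2l xk.
rewrite [m%:R * B^-1 ^+ i](_ : _ = B ^- i.+1 * (m%:R * B)); last first.
  by rewrite exprVn exprS; field; rewrite !gt_eqF.
rewrite exprVn [m%:R * _]mulrC -mulrDr ler_wpM2l ?invr_ge0 ?(ltW (Bn_gt0 _))//.
by rewrite /B -natrM -natrD ler_nat; have := km i; nia.
Qed.

Hypothesis q_ge0 : forall k, (k < m)%N -> 0 <= q k.
Hypothesis q_sum : \sum_(k < m) q k = 1.
Hypothesis q_mod :
  forall r, \sum_(k <- iota 0 m | k == r %[mod b]) q k <= b%:R^-1.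

Lemma mass_itv_le n (x y : R) : x <= y ->
  \sum_(w <- words m n | x <= (wval b w)%:R <= y) weight q w
    <= (y - x + 2) * B ^- n.
Proof.
move=> xy; have Bn_ge0 : 0 <= B ^- n by rewrite invr_ge0 exprn_ge0// ltW.
have w_ge0 w : w \in words m n -> 0 <= weight q w.
  move=> ww; rewrite /weight big_seq prodr_ge0// => i iw.
  exact: q_ge0 (allP (words_lt ww) i iw).
(* No word value is negative. This case is separated because truncation sends a negative [y] to 0,
   which would break [h <= y + 1] below. *)
have [y_lt0|y_ge0] := ltP y 0.
  rewrite big1 => [|w /andP[_ wy]]; first by rewrite mulr_ge0//; lra.
  by have := ler0n R (wval b w); lra.
(* The constant 2 comes from [h <= y + 1] and [x < l + 1]; the latter also holds for negative [x],
   where [l = 0]. *)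
pose l := Num.truncn x; pose h := (Num.truncn y).+1.
apply: (@le_trans _ _ (\sum_(l <= j < h)
    \sum_(w <- words m n | wval b w == j) weight q w)).
  under [leRHS]eq_bigr do rewrite big_mkcond.
  rewrite exchange_big /= big_mkcond big_seq [leRHS]big_seq; apply: ler_sum.
  move=> w ww; case: ifP => [/andP[xw wy]|_]; last first.
    by apply: sumr_ge0 => j _; case: ifP => // _; exact: w_ge0.
  have jw : wval b w \in index_iota l h.
    rewrite mem_index_iota ltnS truncn_ge_nat// wy andbT.
    by rewrite -(natrK (R := R) (wval b w)) le_truncn.
  rewrite (big_rem _ jw) /= eqxx lerDl sumr_ge0// => j _.
  by case: ifP => // _; exact: w_ge0.
apply: (@le_trans _ _ (\sum_(l <= j < h) B ^- n)).
  by apply: ler_sum => j _; exact: mass_le.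
rewrite big_const_nat iter_addr_0 -[leLHS]mulr_natl ler_wpM2r//.
have hy : h%:R <= y + 1 by rewrite /h -natr1 lerD2r truncn_le.
have [hl|lh] := leqP h l.
  by rewrite (eqP (_ : h - l == 0)%N) ?subn_eq0// addr_ge0// subr_ge0.
rewrite natrB ?(ltnW lh)//.
have : x < l%:R + 1.
  rewrite natr1; have [x0|/lt_le_trans->//] := leP 0 x.
  by have /andP[] := truncn_itv x0.
lra.
Qed.

Lemma digit_sum_itv_le (Y : {RV P >-> R}) (x y : R) : as_digit_sum B X Y ->
  x <= y -> (distribution P Y `]x, y]%classic <= (y - x)%:E)%E.
Proof.
move=> XY xy.
(* The error term vanishes as [n] grows: its [m] is the bound on the scaled tail, its 2 the rounding
   loss in [mass_itv_le]. *)
suff bound n : (P (Y @^-1` `]x, y]) <= ((y - x) + (m%:R + 2) * B^-1 ^+ n)%:E)%E.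
  have pE : P (Y @^-1` `]x, y]) = (fine (P (Y @^-1` `]x, y])))%:E.
    by rewrite fineK// fin_num_measure//; exact: measurable_funPTI.
  pose u n := (y - x) + (m%:R + 2) * B^-1 ^+ n.
  have uxy : u @ \oo --> y - x.
    rewrite -[y - x]addr0; apply: cvgD; first exact: cvg_cst.
    by rewrite -[X in _ --> X](mulr0 (m%:R + 2)); apply: cvgMr; exact: B_expV_cvg0.
  rewrite /distribution /pushforward pE lee_fin -(cvg_lim _ uxy)//.
  apply: limr_ge; first by apply/cvg_ex; exists (y - x).
  by apply: nearW => n; rewrite -lee_fin -pE; exact: bound.
(* Outside the null set [N], [Y] in []x, y]] forces the first [n] digits to form a word satisfying
   [C], so the cylinders of these words cover the event. *)
pose C w := B ^+ n * x - m%:R <= (wval b w)%:R <= B ^+ n * y.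
have [N [mN N0 XN]] : {ae P, forall t,
    (forall n, exists2 k, (k < m)%N & X n t = k%:R) /\
    series (fun n => B ^- n.+1 * X n t) @ \oo --> (Y t : R)}.
  by apply: filterS2 XY (as_digits q_sum) => t.
pose U := \big[setU/set0]_(w <- words m n | C w) cylinder w.
have mU : measurable U.
  by apply: bigsetU_measurable => w _; exact: measurable_cylinder.
have YU : Y @^-1` `]x, y] `<=` U `|` N.
  move=> t /=; rewrite in_itv /= => /andP[xt ty].
  have [Nt|Nt] := pselect (N t); [by right|left].
  have [dig XYt] : (forall n, exists2 k, (k < m)%N & X n t = k%:R) /\
    series (fun n => B ^- n.+1 * X n t) @ \oo --> (Y t : R).
    by apply: contrapT => /XN.
  have [k km Xk] : exists2 k : nat -> nat,
      (forall i, (k i < m)%N) & forall i, X i t = (k i)%:R.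
    have [k kP] := choice (fun i => let: ex_intro2 j jm Xj := dig i in
      ex_intro (fun j => (j < m)%N /\ X i t = j%:R) j (conj jm Xj)).
    by exists k => i; have [] := kP i.
  have /andP[lo hi] := digit_series_approx n km Xk XYt.
  rewrite /U -bigcup_seq_cond; exists (mkseq k n) => /=.
    rewrite mkseq_words//= /C; apply/andP; split.
      by apply: le_trans lo; rewrite lerD2r ler_wpM2l ?exprn_ge0// ltW.
    by apply: le_trans hi _; rewrite ler_wpM2l ?exprn_ge0// ltW.
  move=> i /=; rewrite size_mkseq mem_iota add0n => /= ilt.
  by rewrite nth_mkseq.
apply: le_trans (le_measure P _ _ YU) _; rewrite ?inE.
- exact: measurable_funPTI.
- exact: measurableU.
rewrite [leLHS]measureU0//.
apply: le_trans (measure_bigsetU_le _ _ _ _) _; first exact: measurable_cylinder.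
rewrite big_seq_cond (eq_bigr (fun w => (weight q w)%:E)); last first.
  by move=> w /andP[/words_lt wm _]; exact: probability_cylinder.
rewrite -big_seq_cond sumEFin lee_fin; apply: le_trans (mass_itv_le _ _) _.
  have : B ^+ n * x <= B ^+ n * y by rewrite ler_wpM2l ?exprn_ge0// ltW.
  by have := ler0n R m; lra.
rewrite le_eqVlt; apply/orP; left; apply/eqP.
by rewrite exprVn; field; rewrite expf_neq0// gt_eqF.
Qed.

Lemma absolutely_continuous_digit_sum (Y : {RV P >-> R}) :
  as_digit_sum B X Y -> absolutely_continuous_distribution Y.
Proof.
move=> XY A mA A0; apply/eqP; rewrite -measure_le0 -A0.
apply: le_lebesgue_measure => // x y.
exact: digit_sum_itv_le.
Qed.

End digit_sums.

(** * Base 4 with digits 0 to 5 *)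

Theorem theorem2 (d : measure_display) (T : measurableType d) (R : realType)
    (P : probability T R) (xi_ : nat -> {RV P >-> R}) (xi : {RV P >-> R})
    (p0 p1 p2 p3 p4 p5 : R)
    (p := [:: p0; p1; p2; p3; p4; p5])
    (hindep : mutually_independent xi_)
    (hident : identically_distributed xi_)
    (hlaw : forall n k : nat, (k < 6)%N ->
       P (xi_ n @^-1` [set k%:R]) = (p`_k)%:E)
    (hp_ge0 : forall k : nat, (k < 6)%N -> 0 <= p`_k)
    (hp_lt1 : forall k : nat, (k < 6)%N -> p`_k < 1)
    (hp_sum : \sum_(k < 6) p`_k = 1)
    (hxi : as_digit_sum 4 xi_ xi)
    (h2 : p2 = 1 / 4) (h3 : p3 = 1 / 4)
    (h04 : p0 + p4 = 1 / 4) (h15 : p1 + p5 = 1 / 4)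
    (h10 : p0 <= p1) :
  absolutely_continuous_distribution xi.
Proof.
apply: (absolutely_continuous_digit_sum (b := 4) hindep hlaw) => // r.
(* Modulo 4 the digits split into the classes {0, 4}, {1, 5}, {2} and {3}, each of mass exactly
   1/4. *)
rewrite -(modn_mod r) big_mkcond /= !big_cons big_nil.
have : (r %% 4 < 4)%N by rewrite ltn_mod.
by case: (r %% 4)%N => [|[|[|[|]]]]//= _; lra.
Qed.
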